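(* Let $(A,\prec,\succ)$ be a noncommutative Novikov algebra and let $r\in A\otimes A$ be antisymmetric. Then the following statements are equivalent: (a) $r$ is a solution of the Novikov Yang-Baxter equation in $(A,\prec,\succ)$. (b) $r$, viewed as a linear map $A^*\to A$, is an $\mathcal O$-operator of $(A,\prec,\succ)$ associated to the representation $(A^*,-R^*_\bullet,L^*_\succ,R^*_\prec,-L^*_\bullet)$.
   Context: $\mathbf k$ is a field of characteristic $0$; all vector spaces are finite-dimensional over $\mathbf k$, tensor products are over $\mathbf k$. A noncommutative Novikov algebra is a vector space $A$ with bilinear operations $\prec,\succ$ such that, with $\bullet:=\prec+\succ$, $(x\succ y)\prec z=x\succ(y\prec z)$ and $(x\prec y)\bullet z=x\bullet(y\succ z)$ for all $x,y,z\in A$. For a bilinear operation $\circ$ put $L_\circ(x)y=x\circ y=R_\circ(y)x$. For $\rho:A\to\mathrm{End}(V)$ linear, $\rho^*:A\to\mathrm{End}(V^* )$ is defined by $\langle\rho^*(x)u^*,v\rangle=\langle u^*,\rho(x)v\rangle$. An element $r\in A\otimes A$ is antisymmetric if $\sigma(r)=-r$ where $\sigma(x\otimes y)=y\otimes x$. For $r=\sum_iu_i\otimes v_i$, the Novikov Yang-Baxter equation in $(A,\prec,\succ)$ is $$\sum_{i,j}\big(u_i\succ u_j\otimes v_i\otimes v_j+u_i\otimes u_j\otimes v_i\prec v_j+u_i\otimes u_j\bullet v_i\otimes v_j\big)=0 .$$ The element $r$ is viewed as the linear map $A^*\to A$, $a^*\mapsto\sum_i\langle a^*,u_i\rangle v_i$.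 A representation of $(A,\prec,\succ)$ is $(V,\ell_\prec,r_\prec,\ell_\succ,r_\succ)$ with $V$ a vector space and linear maps $\ell_\prec,r_\prec,\ell_\succ,r_\succ:A\to\mathrm{End}(V)$ such that, with $\ell_\bullet=\ell_\prec+\ell_\succ$, $r_\bullet=r_\prec+r_\succ$, for all $x,y\in A$: $\ell_\prec(x\succ y)=\ell_\succ(x)\ell_\prec(y)$; $r_\prec(x)\ell_\succ(y)=\ell_\succ(y)r_\prec(x)$; $r_\prec(x)r_\succ(y)=r_\succ(y\prec x)$; $\ell_\bullet(x\prec y)=\ell_\bullet(x)\ell_\succ(y)$; $r_\bullet(x)\ell_\prec(y)=\ell_\bullet(y)r_\succ(x)$; $r_\bullet(x)r_\prec(y)=r_\bullet(y\succ x)$. The quintuple $(A^*,-R^*_\bullet,L^*_\succ,R^*_\prec,-L^*_\bullet)$ is a representation of $A$ (the coadjoint representation). A linear map $T:V\to A$ is an $\mathcal O$-operator of $(A,\prec,\succ)$ associated to $(V,\ell_\prec,r_\prec,\ell_\succ,r_\succ)$ if $T(u)*T(v)=T\big(\ell_*(T(u))v+r_*(T(v))u\big)$ for all $u,v\in V$ and $*\in\{\prec,\succ\}$. *)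

(* Defs.v *)
From HB Require Import structures.
From mathcomp Require Import all_boot all_order all_algebra.

Set Implicit Arguments.
Unset Strict Implicit.
Unset Printing Implicit Defensive.

Import GRing.Theory.
Local Open Scope ring_scope.

Reserved Notation "u \ox v" (at level 40, left associativity).

Notation is_bilinear f := (bilinear_for *:%R *:%R f).

Section Tensor.
Variables (k : fieldType) (U V : vectType k).

(* The tensor product in coordinates: a tensor is stored as its matrix of     *)
(* coefficients on the e_i \ox f_j, for the library bases e of U and f of V.  *)
(* The universal property is tlift_tens, tlift_linear and tlift_uniq, and     *)
(* tens_decomp says that every tensor is a finite sum of pure tensors.        *)
Definition tensor : Type := 'M[k]_(\dim {:U}, \dim {:V}).

HB.instance Definition _ := Vector.on tensor.

Definition tens (u : U) (v : V) : tensor :=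
  \matrix_(i, j) (coord (vbasis {:U}) i u * coord (vbasis {:V}) j v).

(* The linear map on the tensor product induced by f, for bilinear f. *)
Definition tlift (W : lmodType k) (f : U -> V -> W) (t : tensor) : W :=
  \sum_i \sum_j (t : 'M_(_, _)) i j *: f (vbasis {:U})`_i (vbasis {:V})`_j.

Fact tens_bilinear : is_bilinear tens.
Proof.
split=> [v|u] a x y; apply/matrixP=> i j; rewrite !mxE linearP /=.
  by rewrite mulrDl mulrA.
by rewrite mulrDr mulrCA.
Qed.

Lemma tensPl a u u' v : tens (a *: u + u') v = a *: tens u v + tens u' v.
Proof. exact: tens_bilinear.1. Qed.

Lemma tensPr a u v v' : tens u (a *: v + v') = a *: tens u v + tens u v'.
Proof. exact: tens_bilinear.2. Qed.

HB.instance Definition _ :=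
  bilinear_isBilinear.Build k U V tensor *:%R *:%R tens tens_bilinear.

Fact tlift_linear (W : lmodType k) (f : U -> V -> W) : linear (tlift f).
Proof.
move=> a s t; rewrite /tlift scaler_sumr -big_split; apply: eq_bigr => i _ /=.
rewrite scaler_sumr -big_split; apply: eq_bigr => j _ /=.
by rewrite !mxE scalerDl scalerA.
Qed.

HB.instance Definition _ (W : lmodType k) (f : U -> V -> W) :=
  GRing.isLinear.Build k tensor W *:%R (tlift f) (tlift_linear f).

Lemma tlift_tens (W : lmodType k) (f : U -> V -> W) u v :
  is_bilinear f -> tlift f (tens u v) = f u v.
Proof.
move=> f_bi; pose F : {bilinear U -> V -> W} :=
  HB.pack f (bilinear_isBilinear.Build k U V W *:%R *:%R f f_bi).
rewrite -[f]/(F : U -> V -> W).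
rewrite [in RHS](coord_vbasis (memvf u)) [in RHS](coord_vbasis (memvf v)).
rewrite linear_sumlz; apply: eq_bigr => i _.
rewrite linear_sumr; apply: eq_bigr => j _.
by rewrite linearZl_LR linearZr_LR /= mxE scalerA.
Qed.

Lemma tens_expand (t : tensor) : t =
  \sum_i \sum_j (t : 'M_(_, _)) i j *: tens (vbasis {:U})`_i (vbasis {:V})`_j.
Proof.
apply/matrixP=> i j; rewrite summxE (bigD1 i) //= summxE (bigD1 j) //=.
have fU := basis_free (vbasisP {:U}); have fV := basis_free (vbasisP {:V}).
rewrite !mxE !coord_free // !eqxx !mulr1 !big1 ?addr0 // => [i'|j'] ne.
  rewrite summxE big1 // => j' _.
  by rewrite !mxE !coord_free // (negPf ne) mul0r mulr0.
by rewrite !mxE !coord_free // (negPf ne) mulr0 mulr0.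
Qed.

Lemma tlift_uniq (W : lmodType k) (f : U -> V -> W) (g : {linear tensor -> W}) :
  (forall u v, g (tens u v) = f u v) -> g =1 tlift f.
Proof.
move=> gf t; rewrite {1}(tens_expand t) linear_sum; apply: eq_bigr => i _.
by rewrite linear_sum; apply: eq_bigr => j _; rewrite linearZ /= gf.
Qed.

Lemma tens_decomp (t : tensor) :
  exists s : seq (U * V), t = \sum_(p <- s) tens p.1 p.2.
Proof.
exists [seq ((t : 'M_(_, _)) p.1 p.2 *: (vbasis {:U})`_p.1,
             (vbasis {:V})`_p.2)
       | p <- index_enum ('I_(\dim {:U}) * 'I_(\dim {:V}))%type].
rewrite big_map {1}(tens_expand t) pair_bigA; apply: eq_bigr => -[i j] _ /=.
by rewrite linearZl_LR.
Qed.

Lemma tlift_sum (W : lmodType k) (f : U -> V -> W) I (s : seq I)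
    (u : I -> U) (v : I -> V) : is_bilinear f ->
  tlift f (\sum_(i <- s) tens (u i) (v i)) = \sum_(i <- s) f (u i) (v i).
Proof.
move=> f_bi; rewrite linear_sum; apply: eq_bigr => i _.
exact: tlift_tens.
Qed.

Lemma eq_tlift (W : lmodType k) (f g : U -> V -> W) t :
  (forall u v, f u v = g u v) -> tlift f t = tlift g t.
Proof.
by move=> fg; apply: eq_bigr => i _; apply: eq_bigr => j _; rewrite fg.
Qed.

Lemma tlift_comb (W : lmodType k) (a : k) (f g : U -> V -> W) t :
  tlift (fun u v => a *: f u v + g u v) t = a *: tlift f t + tlift g t.
Proof.
rewrite /tlift scaler_sumr -big_split; apply: eq_bigr => i _ /=.
rewrite scaler_sumr -big_split; apply: eq_bigr => j _ /=.
by rewrite scalerDr !scalerA mulrC.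
Qed.

End Tensor.

Notation "u \ox v" := (tens u v) : ring_scope.

Notation dual V := 'Hom(V, GRing.regular _).

Lemma lfun_of_linear (k : fieldType) (U W : vectType k) (f : U -> W) :
  linear f -> linfun f =1 f.
Proof.
move=> f_lin; pose F : {linear U -> W} :=
  HB.pack f (GRing.isLinear.Build k U W *:%R f f_lin).
exact: (lfunE F).
Qed.

Section TensorSquare.
Variables (k : fieldType) (A : vectType k).

Definition antisymmetric_tensor (r : tensor A A) : Prop :=
  tlift (fun x y => y \ox x) r = - r.

Definition tensor_map (r : tensor A A) : 'Hom(dual A, A) :=
  linfun (fun a : dual A => tlift (fun u v => a u *: v) r).

Lemma antisymmetric_tensorE I (s : seq I) (u v : I -> A) :
  antisymmetric_tensor (\sum_(i <- s) u i \ox v i)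
  <-> \sum_(i <- s) v i \ox u i = - (\sum_(i <- s) u i \ox v i).
Proof.
have [tl tr] := tens_bilinear A A.
by rewrite /antisymmetric_tensor tlift_sum.
Qed.

Lemma tensor_mapE I (s : seq I) (u v : I -> A) (a : dual A) :
  tensor_map (\sum_(i <- s) u i \ox v i) a = \sum_(i <- s) a (u i) *: v i.
Proof.
rewrite /tensor_map lfun_of_linear => [|c f g]; last first.
  rewrite -tlift_comb; apply: eq_tlift => x y.
  by rewrite add_lfunE scale_lfunE scalerDl scalerA.
rewrite tlift_sum //; split=> [y|x] c f g /=.
  by rewrite linearP scalerDl scalerA.
by move: (a x : k) => b; rewrite scalerDr !scalerA mulrC.
Qed.
End TensorSquare.

Section LinearOperators.
Variables (k : fieldType) (A V : vectType k).

Definition lmulop (op : A -> A -> A) : 'Hom(A, 'End(A)) :=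
  linfun (fun x => linfun (fun y => op x y)).
Definition rmulop (op : A -> A -> A) : 'Hom(A, 'End(A)) :=
  linfun (fun y => linfun (fun x => op x y)).

(* No sign: rho^*(x) is the plain transpose of rho(x). *)
Definition dualop (rho : 'Hom(A, 'End(V))) : 'Hom(A, 'End(dual V)) :=
  linfun (fun x => linfun (fun u : dual V => (u \o rho x)%VF)).

Lemma lmulopE op x y : is_bilinear op -> lmulop op x y = op x y.
Proof.
case=> opl opr; rewrite /lmulop lfun_of_linear => [|a u v].
  by rewrite lfun_of_linear.
apply/lfunP=> z; rewrite add_lfunE scale_lfunE !lfun_of_linear //.
exact: opl.
Qed.

Lemma rmulopE op x y : is_bilinear op -> rmulop op y x = op x y.
Proof.
case=> opl opr; rewrite /rmulop lfun_of_linear => [|a u v].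
  by rewrite lfun_of_linear.
apply/lfunP=> z; rewrite add_lfunE scale_lfunE !lfun_of_linear //.
exact: opr.
Qed.

Lemma dualopE rho x (u : dual V) v : dualop rho x u v = u (rho x v).
Proof.
have lin_comp y : linear (fun u : dual V => (u \o rho y)%VF).
  move=> a w z; apply/lfunP=> t.
  by rewrite comp_lfunE !add_lfunE !scale_lfunE !comp_lfunE.
rewrite /dualop lfun_of_linear => [|a y z].
  by rewrite lfun_of_linear // comp_lfunE.
apply/lfunP=> w; rewrite add_lfunE scale_lfunE !lfun_of_linear //.
by apply/lfunP=> t; rewrite add_lfunE scale_lfunE !comp_lfunE linearP
  add_lfunE scale_lfunE linearP.
Qed.

End LinearOperators.

Section NovikovAlgebra.
Variables (k : fieldType) (A : vectType k).

Record ncNovikov := NcNovikov {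
  prec : {bilinear A -> A -> A};
  succ : {bilinear A -> A -> A};
  bullet := fun x y => prec x y + succ x y;
  succ_precA : forall x y z, prec (succ x y) z = succ x (prec y z);
  prec_bulletA : forall x y z, bullet (prec x y) z = bullet x (succ y z)
}.

Variable N : ncNovikov.

Fact prec_bilinear : is_bilinear (prec N).
Proof. by split=> u a x y; rewrite (linearPl, linearPr). Qed.

Fact succ_bilinear : is_bilinear (succ N).
Proof. by split=> u a x y; rewrite (linearPl, linearPr). Qed.

Fact bullet_bilinear : is_bilinear (bullet N).
Proof.
by split=> u a x y; rewrite /bullet !(linearPl, linearPr) /= scalerDr addrACA.
Qed.

Record novRep (V : vectType k) := NovRep {
  lprec : 'Hom(A, 'End(V));
  rprec : 'Hom(A, 'End(V));
  lsucc : 'Hom(A, 'End(V));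
  rsucc : 'Hom(A, 'End(V));
  lbullet := lprec + lsucc;
  rbullet := rprec + rsucc;
  lprec_succ : forall x y, lprec (succ N x y) = (lsucc x \o lprec y)%VF;
  rprec_lsucc : forall x y, (rprec x \o lsucc y = lsucc y \o rprec x)%VF;
  rprec_rsucc : forall x y, (rprec x \o rsucc y)%VF = rsucc (prec N y x);
  lbullet_prec : forall x y, lbullet (prec N x y) = (lbullet x \o lsucc y)%VF;
  rbullet_lprec : forall x y, (rbullet x \o lprec y = lbullet y \o rsucc x)%VF;
  rbullet_rprec : forall x y, (rbullet x \o rprec y)%VF = rbullet (succ N y x)
}.

Definition o_operator (V : vectType k) (rho : novRep V) (T : 'Hom(V, A)) :=
  (forall u v, prec N (T u) (T v) = T (lprec rho (T u) v + rprec rho (T v) u))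
  /\
  (forall u v, succ N (T u) (T v) = T (lsucc rho (T u) v + rsucc rho (T v) u)).

Local Notation opE := (lmulopE _ _ prec_bilinear, lmulopE _ _ succ_bilinear,
  lmulopE _ _ bullet_bilinear, rmulopE _ _ prec_bilinear,
  rmulopE _ _ succ_bilinear, rmulopE _ _ bullet_bilinear).
Local Notation lfE := (comp_lfunE, add_lfunE, opp_lfunE, dualopE, opE).

Let lbullet_coadjoint x (u : dual A) z :
  (- dualop (rmulop (bullet N)) + dualop (rmulop (prec N))) x u z
  = - u (succ N z x).
Proof. by rewrite !lfE /bullet linearD opprD addrAC addNr add0r. Qed.

Let rbullet_coadjoint x (u : dual A) z :
  (dualop (lmulop (succ N)) - dualop (lmulop (bullet N))) x u z
  = - u (prec N x z).
Proof. by rewrite !lfE /bullet linearD opprD addrCA subrr addr0. Qed.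

Program Definition coadjoint : novRep (dual A) := {|
  lprec := - dualop (rmulop (bullet N));
  rprec := dualop (lmulop (succ N));
  lsucc := dualop (rmulop (prec N));
  rsucc := - dualop (lmulop (bullet N))
|}.
Next Obligation.
by move=> x y; apply/lfunP=> u; apply/lfunP=> z; rewrite !lfE prec_bulletA.
Qed.
Next Obligation.
by move=> x y; apply/lfunP=> u; apply/lfunP=> z; rewrite !lfE succ_precA.
Qed.
Next Obligation.
by move=> x y; apply/lfunP=> u; apply/lfunP=> z; rewrite !lfE prec_bulletA.
Qed.
Next Obligation.
move=> x y; apply/lfunP=> u; apply/lfunP=> z.
by rewrite comp_lfunE !lbullet_coadjoint !lfE succ_precA.
Qed.
Next Obligation.
move=> x y; apply/lfunP=> u; apply/lfunP=> z; rewrite !comp_lfunE.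
by rewrite lbullet_coadjoint rbullet_coadjoint !lfE prec_bulletA.
Qed.
Next Obligation.
move=> x y; apply/lfunP=> u; apply/lfunP=> z.
by rewrite comp_lfunE !rbullet_coadjoint !lfE succ_precA.
Qed.

(* The left-hand side of the Novikov Yang-Baxter equation, extended           *)
(* bilinearly in the two copies of r; nybe_lhsE is the usual formula.         *)
Definition nybe_lhs (r : tensor A A) : tensor (tensor A A) A :=
  tlift (fun ui vi => tlift (fun uj vj =>
    succ N ui uj \ox vi \ox vj
    + ui \ox uj \ox prec N vi vj
    + ui \ox bullet N uj vi \ox vj) r) r.

Definition nybe_solution (r : tensor A A) : Prop := nybe_lhs r = 0.

Lemma nybe_lhsE I (s : seq I) (u v : I -> A) :
  nybe_lhs (\sum_(i <- s) u i \ox v i)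
  = \sum_(i <- s) \sum_(j <- s)
      (succ N (u i) (u j) \ox v i \ox v j
       + u i \ox u j \ox prec N (v i) (v j)
       + u i \ox bullet N (u j) (v i) \ox v j).
Proof.
have pl a x y z : prec N (a *: x + y) z = a *: prec N x z + prec N y z.
  exact: prec_bilinear.1.
have pr a x y z : prec N z (a *: x + y) = a *: prec N z x + prec N z y.
  exact: prec_bilinear.2.
have sl a x y z : succ N (a *: x + y) z = a *: succ N x z + succ N y z.
  exact: succ_bilinear.1.
have sr a x y z : succ N z (a *: x + y) = a *: succ N z x + succ N z y.
  exact: succ_bilinear.2.
have bl a x y z : bullet N (a *: x + y) z = a *: bullet N x z + bullet N y z.
  exact: bullet_bilinear.1.
have br a x y z : bullet N z (a *: x + y) = a *: bullet N z x + bullet N z y.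
  exact: bullet_bilinear.2.
pose bE := (pl, pr, sl, sr, bl, br, tensPl, tensPr).
have ac3 (a : k) (x y z x' y' z' : tensor (tensor A A) A) :
  a *: x + x' + (a *: y + y') + (a *: z + z')
  = a *: (x + y + z) + (x' + y' + z').
  rewrite !scalerDr [RHS]addrACA; congr (_ + _); exact: addrACA.
rewrite /nybe_lhs tlift_sum; last first.
  split=> [vi|ui] a x y; rewrite -tlift_comb; apply: eq_tlift => uj vj;
    by rewrite !bE ac3.
apply: eq_bigr => i _; rewrite tlift_sum //.
by split=> [vj|uj] a x y; rewrite !bE ac3.
Qed.

End NovikovAlgebra.

(* Main.v *)
Require Import Defs.
From HB Require Import structures.
From mathcomp Require Import all_boot all_order all_algebra.
From mathcomp Require Import ring.

(** Write [T] for the map [tensor_map r] from [A^*] to [A].  Both conditions on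
    [r] are equivalent to the vanishing, for all [a b c : A^*], of the single
    trilinear form

      P(a, b, c) = c (T a < T b) + a (T b > T c) - b (T c . T a),

    where [<], [>], [.] stand for [prec], [succ], [bullet] ([nybe_form]).

    Antisymmetry says that contracting [r] on the right gives [- T] where
    contracting it on the left gives [T]; equivalently, [c (T a) = - a (T c)]
    ([tensor_map_skew]).  Applying [a], [b], [c] to the three legs of the
    Novikov Yang-Baxter tensor therefore gives [P(a, b, c)]: two right
    contractions occur in the [succ] term, where their signs cancel, and one in
    the [bullet] term, which is why [P] has a minus sign there
    ([nybe_lhs_form]).  Since linear forms separate tensors ([contract_eq0]),
    [r] is a solution if and only if [P] vanishes ([nybe_solution_form]).

    On the other side, evaluating the defect of the first O-operator identity at
    [c], and moving [T] across with the skew symmetry, gives [P(a, b, c)] again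
    ([prec_defect_form]).  The same computation for the second identity gives
    [- (P(a, b, c) + P(b, c, a))] ([succ_defect_form]), because
    [bullet = prec + succ] makes two pairs of terms in this sum cancel.  Hence
    the first identity alone amounts to [P = 0], and it implies the second. *)

Set Implicit Arguments.
Unset Strict Implicit.
Unset Printing Implicit Defensive.

Import GRing.Theory.
Local Open Scope ring_scope.

Section CoordinateForms.
Variables (k : fieldType) (U : vectType k).

Definition coord_form (i : 'I_(\dim {:U})) : dual U :=
  linfun (coord (vbasis {:U}) i : U -> k^o).

Lemma coord_formE i x : coord_form i x = coord (vbasis {:U}) i x.
Proof. by rewrite /coord_form lfun_of_linear // => a u v; rewrite linearP. Qed.

Lemma coord_form_basis i (j : 'I_(\dim {:U})) :
  coord_form i (vbasis {:U})`_j = (i == j)%:R.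
Proof.
by rewrite coord_formE (coord_free _ _ (basis_free (vbasisP _))) eq_sym.
Qed.

Lemma dual_separates (x : U) : (forall a : dual U, a x = 0) -> x = 0.
Proof.
move=> ax0; rewrite (coord_vbasis (memvf x)) big1 // => i _.
by rewrite -coord_formE ax0 scale0r.
Qed.

End CoordinateForms.

Section Contraction.
Variables (k : fieldType) (U V : vectType k).

Definition contract (c : dual V) (t : tensor U V) : U :=
  tlift (fun u v => (c v : k) *: u) t.

Fact contract_linear c : linear (contract c).
Proof. exact: tlift_linear. Qed.

HB.instance Definition _ c :=
  GRing.isLinear.Build k (tensor U V) U *:%R (contract c) (contract_linear c).

Lemma contract_tens c u v : contract c (u \ox v) = (c v : k) *: u.
Proof.
rewrite /contract tlift_tens //; split=> [y|x] a f g /=.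
  by rewrite scalerDr !scalerA mulrC.
by rewrite linearP scalerDl scalerA.
Qed.

Lemma contract_sum c I (s : seq I) (u : I -> U) (v : I -> V) :
  contract c (\sum_(i <- s) u i \ox v i) = \sum_(i <- s) (c (v i) : k) *: u i.
Proof.
by rewrite linear_sum; apply: eq_bigr => i _ /=; rewrite contract_tens.
Qed.

(** Contracting with the [j]-th coordinate form reads off the [j]-th column of
    the coefficient matrix of [t]. *)
Lemma contract_eq0 (t : tensor U V) : (forall c, contract c t = 0) -> t = 0.
Proof.
move=> ct0; apply/matrixP=> i j; rewrite mxE.
have := congr1 (coord_form i) (ct0 (coord_form j)).
rewrite linear0 => <-.
rewrite /contract /tlift linear_sum (bigD1 i) //= linear_sum (bigD1 j) //=.
rewrite !linearZ /= !coord_form_basis !eqxx.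
rewrite big1 => [|j' ne]; last first.
  by rewrite !linearZ /= coord_form_basis eq_sym (negPf ne) scale0r scaler0.
rewrite big1 => [|i' ne]; last first.
  rewrite linear_sum big1 // => j' _.
  by rewrite !linearZ /= !coord_form_basis (eq_sym i) (negPf ne) !scaler0.
by rewrite !addr0 scale1r [RHS]mulr1.
Qed.

End Contraction.

Lemma bilinear_expand (k : fieldType) (A : vectType k) (f : A -> A -> A)
    (a : dual A) I (s : seq I) (x y : I -> k) (u v : I -> A) :
  is_bilinear f ->
  a (f (\sum_(i <- s) x i *: u i) (\sum_(j <- s) y j *: v j))
  = \sum_(i <- s) \sum_(j <- s) x i * y j * a (f (u i) (v j)).
Proof.
move=> f_bi; pose F : {bilinear A -> A -> A} :=
  HB.pack f (bilinear_isBilinear.Build k A A A *:%R *:%R f f_bi).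
rewrite -[f]/(F : A -> A -> A) linear_sumlz linear_sum.
apply: eq_bigr => i _; rewrite linear_sumr linear_sum.
by apply: eq_bigr => j _; rewrite linearZl_LR linearZr_LR /= !linearZ /= scalerA.
Qed.

Section NovikovForm.
Variables (k : fieldType) (A : vectType k) (N : ncNovikov A) (r : tensor A A).
Hypothesis r_antisym : antisymmetric_tensor r.

Local Notation T := (tensor_map r).

Lemma contract_antisym c : contract c r = - T c.
Proof.
have [s def_r] := tens_decomp r; move: r_antisym.
rewrite {1}def_r => /antisymmetric_tensorE; rewrite -def_r.
move/(congr1 (contract c)); rewrite linearN /= => /eqP.
rewrite eq_sym eqr_oppLR => /eqP ->.
by rewrite def_r tensor_mapE contract_sum.
Qed.

(** Both sides pair [r] with [a] and [c]: the left-hand side puts [a] on the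
    first leg, and [a (T c)] puts it on the second. *)
Lemma tensor_map_skew (a c : dual A) : c (T a) = - a (T c).
Proof.
rewrite -linearN -contract_antisym; have [s ->] := tens_decomp r.
rewrite tensor_mapE contract_sum !linear_sum; apply: eq_bigr => p _ /=.
by rewrite !linearZ /= [LHS]mulrC.
Qed.

(** The trilinear form whose vanishing both conditions on [r] express; its
    arguments are in the order of the legs of the Novikov Yang-Baxter tensor. *)
Definition nybe_form (a b c : dual A) : k :=
  c (prec N (T a) (T b)) + a (succ N (T b) (T c)) - b (bullet N (T c) (T a)).

(** In each summand of the equation, two legs are single components of [r]; the
    forms applied to them contract the two copies of [r] to values of [T] or
    [- T], and the remaining leg is the product of these two values. *)
Lemma nybe_lhs_form (a b c : dual A) :
  a (contract b (contract c (nybe_lhs N r))) = nybe_form a b c.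
Proof.
have [s def_r] := tens_decomp r.
have Tl d : T d = \sum_(p <- s) (d p.1 : k) *: p.2.
  by rewrite def_r tensor_mapE.
have Tr d : - T d = \sum_(p <- s) (d p.2 : k) *: p.1.
  by rewrite -contract_antisym {1}def_r contract_sum.
rewrite /nybe_form.
(* Contractions on the second leg of [r] produce [- T], so the signs are moved
   onto the arguments that come from such contractions. *)
have -> : succ N (T b) (T c) = succ N (- T b) (- T c).
  by rewrite linearNl linearNr opprK.
have -> : - b (bullet N (T c) (T a)) = b (bullet N (- T c) (T a)).
  by rewrite /bullet !linearNl /= -opprD linearN.
rewrite !Tr !Tl {1}def_r nybe_lhsE.
rewrite !bilinear_expand; [|exact: bullet_bilinear|exact: succ_bilinear
  |exact: prec_bilinear].
(* In the [bullet] term the inner copy of [r] supplies the left factor. *)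
rewrite [X in _ = _ + X]exchange_big -!big_split /=.
rewrite (linear_sum (contract c)) (linear_sum (contract b)) linear_sum.
apply: eq_bigr => p _; rewrite -!big_split /=.
rewrite (linear_sum (contract c)) (linear_sum (contract b)) linear_sum.
apply: eq_bigr => q _ /=.
rewrite !(linearD (contract c)) !(linearD (contract b)) !(linearD a) /=.
rewrite !contract_tens !linearZ /= !contract_tens !linearZ /=.
move: (a p.1 : k) (b p.2 : k) (b q.1 : k) (c q.2 : k) => a1 b2 b1 c2.
move: (a _ : k) (b _ : k) (c _ : k) => x y z.
have regularE (t u : k) : t *: (u : k^o) = t * u by [].
by rewrite !regularE; ring.
Qed.

Lemma nybe_solution_form :
  nybe_solution N r <-> forall a b c, nybe_form a b c = 0.
Proof.
split=> [sol a b c | P0].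
  by rewrite -nybe_lhs_form sol !linear0.
apply: contract_eq0 => c; apply: contract_eq0 => b.
by apply: dual_separates => a; rewrite nybe_lhs_form.
Qed.

(** The coadjoint operators are transposes, so once the skew symmetry has moved
    [T] off the right-hand side, each term evaluates to a product in [A]. *)
Lemma prec_defect_form (a b c : dual A) :
  c (prec N (T a) (T b)
     - T (lprec (coadjoint N) (T a) b + rprec (coadjoint N) (T b) a))
  = nybe_form a b c.
Proof.
rewrite linearB /= [in X in _ - X]tensor_map_skew opprK /=.
rewrite !(add_lfunE, opp_lfunE, dualopE).
rewrite lmulopE ?rmulopE; [|exact: bullet_bilinear|exact: succ_bilinear].
by rewrite /nybe_form addrA addrAC.
Qed.

(** Expanding [bullet], the terms [c (T a < T b)] and [b (T c > T a)] of the two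
    forms cancel; what remains is the second O-operator identity. *)
Lemma succ_defect_form (a b c : dual A) :
  c (succ N (T a) (T b)
     - T (lsucc (coadjoint N) (T a) b + rsucc (coadjoint N) (T b) a))
  = - (nybe_form a b c + nybe_form b c a).
Proof.
rewrite linearB /= [in X in _ - X]tensor_map_skew opprK /=.
rewrite !(add_lfunE, opp_lfunE, dualopE).
rewrite lmulopE ?rmulopE; [|exact: prec_bilinear|exact: bullet_bilinear].
rewrite /nybe_form /bullet !linearD /=.
move: (a _ : k) (a _ : k) (b _ : k) (b _ : k) (c _ : k) (c _ : k).
by move=> ? ? ? ? ? ?; ring.
Qed.

End NovikovForm.

Theorem proposition3p5 (k : fieldType) (char_k : [pchar k] =i pred0)
    (A : vectType k) (N : ncNovikov A) (r : tensor A A)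
    (r_antisym : antisymmetric_tensor r) :
  nybe_solution N r <-> o_operator (coadjoint N) (tensor_map r).
Proof.
have [sol_form form_sol] := nybe_solution_form N r_antisym.
split=> [/sol_form P0 | [prec_T _]].
  split=> a b; apply/eqP; rewrite -subr_eq0; apply/eqP;
    apply: dual_separates => c.
    by rewrite prec_defect_form.
  by rewrite succ_defect_form // !P0 addr0 oppr0.
apply: form_sol => a b c.
by rewrite -prec_defect_form // prec_T subrr linear0.
Qed.
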